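(* Let $K$ be an algebraically closed field, let $R=K[x_1,\dots,x_N]$ be a polynomial ring over $K$, let $m\le n$ be positive integers, let $t$ be an integer with $1\le t\le m$, and let $X$ be an $(m\times n)$-matrix with entries in $R$. Suppose that, for some integer $k$ such that $1\le k\le \min\{2t+1,\,m+n-2t\}$, there are $k$ entries of $X$, lying on consecutive antidiagonals starting from the left (upper-left corner), that are zero. Then \[ \operatorname{ara} I_t(X)\le mn-t^2-k+1 . \]
   Context: $I_t(X)$ denotes the ideal of $R$ generated by all $t$-minors of $X$, i.e. the determinants of all $(t\times t)$-submatrices of $X$. For an ideal $I$ of a Noetherian ring $S$, the arithmetical rank $\operatorname{ara} I$ is the minimum number $r$ of elements $f_1,\dots,f_r\in S$ such that $\sqrt{I}=\sqrt{(f_1,\dots,f_r)}$. For $h=1,\dots,m+n-1$, the $h$-th antidiagonal of an $(m\times n)$-matrix consists of the entries at positions $(i,j)$ with $1\le i\le m$, $1\le j\le n$ and $i+j=h+1$. A set of positions is said to lie on consecutive antidiagonals starting from the left if the set of indices of the antidiagonals containing at least one of these positions is $\{1,2,\dots,s\}$ for some $s\ge 1$ (so in particular the position $(1,1)$ belongs to the set; the antidiagonals need not be completely filled). *)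

(* Defs.v *)
From mathcomp Require Import all_boot all_order all_algebra.
From mathcomp.multinomials Require Import mpoly.

Set Implicit Arguments.
Unset Strict Implicit.
Unset Printing Implicit Defensive.

Import GRing.Theory.
Local Open Scope ring_scope.

(* Ideals are represented by their membership predicates [S -> Prop]. *)
Section Ideals.
Variable S : comNzRingType.

Definition ideal_gen (P : S -> Prop) : S -> Prop := fun x =>
  exists (r : nat) (a g : 'I_r -> S),
    (forall i, P (g i)) /\ x = \sum_(i < r) a i * g i.

Definition radical (I : S -> Prop) : S -> Prop := fun x =>
  exists2 e : nat, (0 < e)%N & I (x ^+ e).

Definition generated_up_to_radical (I : S -> Prop) (r : nat) : Prop :=
  exists f : 'I_r -> S,
    forall x, radical I x <-> radical (ideal_gen (fun y => exists i, y = f i)) x.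

(* [is_ara I r] is "ara I = r"; such an r exists (and is then unique) as soon
   as I is a finitely generated ideal. *)
Definition is_ara (I : S -> Prop) (r : nat) : Prop :=
  generated_up_to_radical I r /\
  forall s, generated_up_to_radical I s -> (r <= s)%N.

Definition is_minor (m n t : nat) (X : 'M[S]_(m, n)) (d : S) : Prop :=
  exists (f : 'I_t -> 'I_m) (g : 'I_t -> 'I_n),
    [/\ {homo f : i j / (i < j)%N}, {homo g : i j / (i < j)%N}
      & d = \det (mxsub f g X)].

Definition minor_ideal (m n t : nat) (X : 'M[S]_(m, n)) : S -> Prop :=
  ideal_gen (is_minor t X).

End Ideals.

(* Rows and columns are numbered from 0 here, so that the h-th antidiagonal,
   (i + 1) + (j + 1) = h + 1, is i + j + 1 = h. *)
Definition antidiag (m n : nat) (p : 'I_m * 'I_n) : nat := (p.1 + p.2).+1.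

Definition on_consecutive_antidiags (m n : nat) (Z : {set 'I_m * 'I_n}) : Prop :=
  exists2 s : nat, (1 <= s)%N &
    forall h : nat, (exists2 p, p \in Z & antidiag p = h) <-> (1 <= h <= s)%N.

(* Main.v *)
(** Give a minor the weight obtained by summing, over its diagonal, the
    antidiagonal indices counted from the lower right corner. For minors of size
    at least t the weights range over t^2, ..., mn. If all minors of weight > v
    vanish modulo a radical ideal Q, then products of two distinct minors of
    weight v lie in Q, so Q contains all minors of weight v as soon as it
    contains their sum F_v; this is the argument of Bruns and Vetter for the
    bound mn - t^2 + 1 on generic matrices.
    To save the k sums of lowest weight, replace the zeros of X, taken from the
    last antidiagonal to the first, by F_v for v = t^2, ..., t^2 + k - 1. The
    resulting matrix Y is congruent to X modulo I_t(X). If a minor of weight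
    v = t^2 + a is nonzero while all those of higher weight vanish, then the
    rows above it and the columns to the left of it vanish, hence so does the
    entry of Y that was set to F_v. Thus F_v vanishes for these v as well, and
    the remaining F_v(Y) generate I_t(X) up to radical. *)
Require Import Defs.
From mathcomp Require Import all_boot all_order all_algebra.
From mathcomp Require Import fingroup perm.
From mathcomp Require Import zify ring.
From Stdlib Require Classical_Prop.
From mathcomp.multinomials Require Import mpoly.

Set Implicit Arguments.
Unset Strict Implicit.
Unset Printing Implicit Defensive.

Import GRing.Theory.

(** * Ideals, congruences, radicals and the arithmetical rank *)

Section Ideals.
Variable R : comNzRingType.
Local Open Scope ring_scope.

Record is_ideal (I : R -> Prop) : Prop := IsIdeal {
  idl0 : I 0;
  idlD : forall x y, I x -> I y -> I (x + y);
  idlMl : forall a x, I x -> I (a * x) }.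

(** The exponent 0 does no harm: an ideal containing 1 contains every [x]. *)
Definition is_radical_ideal (I : R -> Prop) : Prop :=
  is_ideal I /\ forall x e, I (x ^+ e) -> I x.

Section Closure.
Variable I : R -> Prop.
Hypothesis idI : is_ideal I.

Lemma idlMr a x : I x -> I (x * a).
Proof. by rewrite mulrC; apply: idlMl. Qed.

Lemma idlN x : I x -> I (- x).
Proof. by rewrite -mulN1r; apply: idlMl. Qed.

Lemma idl_sum (T : Type) (r : seq T) (P : pred T) (F : T -> R) :
  (forall i, P i -> I (F i)) -> I (\sum_(i <- r | P i) F i).
Proof. by move=> IF; apply: big_ind => //; [apply: idl0|apply: idlD]. Qed.

Lemma idl_prod (T : finType) (i0 : T) (F : T -> R) :
  I (F i0) -> I (\prod_i F i).
Proof. by move=> IF; rewrite (bigD1 i0) //=; apply: idlMr. Qed.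

Lemma congM a b c d : I (a - b) -> I (c - d) -> I (a * c - b * d).
Proof.
move=> Iab Icd; have -> : a * c - b * d = (a - b) * c + b * (c - d) by ring.
by apply: idlD => //; [apply: idlMr|apply: idlMl].
Qed.

Lemma idl_cong x y : I (x - y) -> I y -> I x.
Proof. by move=> Ixy Iy; rewrite -(subrK y x); apply: idlD. Qed.

Lemma cong_sym x y : I (x - y) -> I (y - x).
Proof. by rewrite -(opprB x y); apply: idlN. Qed.

Lemma cong_det s (A B : 'M[R]_s) :
  (forall i j, I (A i j - B i j)) -> I (\det A - \det B).
Proof.
move=> AB; rewrite /determinant -sumrB; apply: idl_sum => p _.
rewrite -mulrBr; apply: idlMl => //.
apply: (big_ind2 (fun x y => I (x - y))) => //.
- by rewrite subrr; apply: idl0.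
- by move=> *; apply: congM.
Qed.

End Closure.

Lemma ideal_gen_ideal (P : R -> Prop) : is_ideal (ideal_gen P).
Proof.
split.
- exists 0%N, (fun=> 0), (fun=> 0); split=> [[]//|]; by rewrite big_ord0.
- move=> _ _ [r [a [g [Pg ->]]]] [r' [a' [g' [Pg' ->]]]].
  pose h T (u : 'I_r -> T) (u' : 'I_r' -> T) (k : 'I_(r + r')) :=
    match split k with inl i => u i | inr i => u' i end.
  have hl T (u : _ -> T) u' i : h T u u' (lshift r' i) = u i.
    by rewrite /h -/(unsplit (inl i)) unsplitK.
  have hr T (u : _ -> T) u' i : h T u u' (rshift r i) = u' i.
    by rewrite /h -/(unsplit (inr i)) unsplitK.
  exists (r + r')%N, (h _ a a'), (h _ g g'); split.
    by move=> k; rewrite /h; case: split.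
  by rewrite big_split_ord /=; congr (_ + _); apply: eq_bigr => i _;
    rewrite !(hl, hr).
- move=> b _ [r [a [g [Pg ->]]]]; exists r, (fun i => b * a i), g; split=> //.
  by rewrite mulr_sumr; apply: eq_bigr => i _; rewrite mulrA.
Qed.

Lemma ideal_gen_sub (P I : R -> Prop) : is_ideal I ->
  (forall x, P x -> I x) -> forall x, ideal_gen P x -> I x.
Proof.
move=> idI PI _ [r [a [g [Pg ->]]]]; apply: idl_sum => // i _.
by apply: idlMl => //; apply: PI.
Qed.

Lemma ideal_gen_mem (P : R -> Prop) x : P x -> ideal_gen P x.
Proof.
move=> Px; exists 1%N, (fun=> 1), (fun=> x); split=> //.
by rewrite big_ord1 mul1r.
Qed.

Lemma radical_radical (I : R -> Prop) :
  is_ideal I -> is_radical_ideal (radical I).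
Proof.
move=> idI; split; last first.
  move=> x [|e]; first by case=> e; rewrite expr0 expr1n => _ I1;
    exists 1%N => //; rewrite -[x ^+ 1]mulr1; apply: idlMl.
  by case=> f f0 If; exists (e.+1 * f)%N; rewrite ?muln_gt0 // exprM.
split.
- by exists 1%N => //; rewrite expr1; apply: idl0.
- move=> x y [e e0 Ie] [f f0 If]; exists (e + f)%N.
    by rewrite addn_gt0 e0.
  rewrite exprDn; apply: idl_sum => // i _; rewrite -mulr_natr.
  apply: idlMr => //; have [fi|fi] := leqP f i.
    by apply: idlMl => //; rewrite -(subnK fi) exprD; apply: idlMl.
  apply: idlMr => //; have -> : (e + f - i = (f - i) + e)%N by lia.
  by rewrite exprD; apply: idlMl.
- by move=> a x [e e0 Ie]; exists e => //; rewrite exprMn; apply: idlMl.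
Qed.

Lemma radical_sub (I J : R -> Prop) : is_radical_ideal J ->
  (forall x, I x -> J x) -> forall x, radical I x -> J x.
Proof. by move=> [_ rJ] IJ x [e _ /IJ/rJ]. Qed.

Lemma sub_radical (I : R -> Prop) x : I x -> radical I x.
Proof. by exists 1%N; rewrite ?expr1. Qed.

(** No decision procedure says whether [s] elements suffice, so the minimum comes from strong
    induction and excluded middle. *)
Lemma is_ara_le (I : R -> Prop) r : generated_up_to_radical I r ->
  exists2 s, is_ara I s & (s <= r)%N.
Proof.
elim/ltn_ind: r => r IH Ir.
have [[s [sr Is]]|min] := Classical_Prop.classic
    (exists s, (s < r)%N /\ generated_up_to_radical I s).
  by have [u Iu us] := IH s sr Is; exists u => //; lia.
exists r => //; split=> // s Is; rewrite leqNgt; apply/negP => sr.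
by apply: min; exists s.
Qed.

End Ideals.

(** * Row and column sequences of minors, and their weights *)

Section Index.
Local Open Scope nat_scope.

Definition increasing s m (c : 'I_s -> 'I_m) : bool :=
  [forall i : 'I_s, forall j : 'I_s, (i < j) ==> (c i < c j)].

Definition coweight s m (c : 'I_s -> 'I_m) : nat := \sum_l (m - (c l).+1).

(* The sum over [l] of the antidiagonal indices, counted from the lower right
   corner, of the positions [(c l, d l)]. *)
Definition weight s m n (c : 'I_s -> 'I_m) (d : 'I_s -> 'I_n) : nat :=
  coweight c + coweight d + s.

Lemma weightC s m n (c : 'I_s -> 'I_m) (d : 'I_s -> 'I_n) :
  weight c d = weight d c.
Proof. by rewrite /weight [coweight c + _]addnC. Qed.

Lemma increasingP s m (c : 'I_s -> 'I_m) :
  reflect {homo c : i j / (i < j)%N} (increasing c).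
Proof.
apply: (iffP forallP) => [inc i j ij|inc i].
  by move/forallP/(_ j)/implyP/(_ ij): (inc i).
by apply/forallP => j; apply/implyP/inc.
Qed.

Lemma increasing_lower s m (c : 'I_s -> 'I_m) : increasing c ->
  forall l : 'I_s, l <= c l.
Proof.
move/increasingP=> inc [l ls]; elim: l ls => //= l IH ls.
have ls' := ltnW ls; apply: leq_ltn_trans (IH ls') _.
exact: (inc (Ordinal ls') (Ordinal ls)).
Qed.

Lemma increasing_gap s m (c : 'I_s -> 'I_m) : increasing c ->
  forall i j : 'I_s, i <= j -> c i + (j - i) <= c j.
Proof.
move/increasingP=> inc i [j js] /=; elim: j js => [|j IH] js ij.
  have -> : i = Ordinal js by apply: val_inj => /=; lia.
  by rewrite sub0n addn0.
have [ji|ji] := ltnP j i.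
  have -> : i = Ordinal js by apply: val_inj => /=; lia.
  by rewrite /= subnn addn0.
have js' := ltnW js; have := IH js' ji.
have /= := inc (Ordinal js') (Ordinal js) (ltnSn j); lia.
Qed.

Lemma increasing_upper s m (c : 'I_s -> 'I_m) : increasing c ->
  forall l : 'I_s, s - l.+1 <= m - (c l).+1.
Proof.
case: s c => [c _ []//|s c inc l].
have := increasing_gap inc (leq_ord l : l <= ord_max).
have := ltn_ord (c ord_max); have := ltn_ord l; rewrite /=; lia.
Qed.

Lemma increasing_size s m (c : 'I_s -> 'I_m) : increasing c -> s <= m.
Proof.
case: s c => // s c inc.
have := increasing_lower inc ord_max; have := ltn_ord (c ord_max).
by rewrite /=; lia.
Qed.

Lemma sum_rev s : \sum_(l < s) (s - l.+1) = \sum_(l < s) l.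
Proof.
rewrite (reindex_inj rev_ord_inj); apply: eq_bigr => l _ /=.
by have := ltn_ord l; lia.
Qed.

Lemma double_sum_ord s : 2 * (\sum_(l < s) l) + s = s ^ 2.
Proof.
elim: s => [|s]; first by rewrite big_ord0.
by rewrite big_ord_recr /= -!mulnn; nia.
Qed.

(** Every index is at least as far from the end as in the lower right block, whose weight is
    [s ^ 2]. *)
Lemma weight_ge s m n (c : 'I_s -> 'I_m) (d : 'I_s -> 'I_n) :
  increasing c -> increasing d -> s ^ 2 <= weight c d.
Proof.
move=> ic id; rewrite -double_sum_ord -sum_rev mul2n -addnn /weight leq_add2r.
by apply: leq_add; apply: leq_sum => l _; apply: increasing_upper.
Qed.

(** The upper left block gives the bound [s * (m + n) - s ^ 2], which is
    [m * n - (m - s) * (n - s)]. *)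
Lemma weight_le s m n (c : 'I_s -> 'I_m) (d : 'I_s -> 'I_n) :
  increasing c -> increasing d -> weight c d <= m * n.
Proof.
move=> ic id; have sm := increasing_size ic; have sn := increasing_size id.
have H p (e : 'I_s -> 'I_p) : increasing e ->
    coweight e + \sum_(l < s) l + s <= s * p.
  move=> ie; have -> : s * p = \sum_(l < s) p by rewrite sum_nat_const card_ord.
  have E : \sum_(l < s) 1 = s by rewrite sum1_card card_ord.
  rewrite -[X in _ + X]E /coweight -!big_split /=.
  apply: leq_sum => l _; have := increasing_lower ie l.
  by have := ltn_ord (e l); lia.
have := H _ _ ic; have := H _ _ id; have := double_sum_ord s; rewrite /weight.
move: (coweight c) (coweight d) (\sum_(l < s) l) => a b S.
rewrite -(subnKC sm) -(subnKC sn) -mulnn; move: (m - s) (n - s) => u v.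
by rewrite !mulnDl !mulnDr (mulnC u s); lia.
Qed.

(** The first diagonal entry contributes [m + n - (c ord0 + d ord0).+1], the other [s] at least
    [s ^ 2]. *)
Lemma weight_first s m n (c : 'I_s.+1 -> 'I_m) (d : 'I_s.+1 -> 'I_n) :
  increasing c -> increasing d ->
  m + n + s ^ 2 <= weight c d + (c ord0 + d ord0).+1.
Proof.
move=> ic id.
have H p (e : 'I_s.+1 -> 'I_p) : increasing e ->
    p + \sum_(l < s) l <= coweight e + (e ord0).+1.
  move=> ie; rewrite /coweight big_ord_recl -sum_rev.
  have : \sum_(l < s) (s - l.+1)
      <= \sum_(l < s) (p - (e (lift ord0 l)).+1).
    apply: leq_sum => l _; have := increasing_upper ie (lift ord0 l).
    by rewrite /= /bump /=; lia.
  by have := ltn_ord (e ord0); lia.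
have := H _ _ ic; have := H _ _ id; have := double_sum_ord s; rewrite /weight.
lia.
Qed.

Lemma coweight_perm s m (c : 'I_s -> 'I_m) (p : 'S_s) :
  coweight (c \o p) = coweight c.
Proof. by rewrite /coweight [RHS](reindex_inj (@perm_inj _ p)). Qed.

(** The weight drops strictly whenever an index grows. *)
Lemma eq_increasing_le s m n (c c' : 'I_s -> 'I_m) (d d' : 'I_s -> 'I_n) :
  weight c d = weight c' d' ->
  (forall l, c l <= c' l) -> (forall l, d l <= d' l) -> c =1 c' /\ d =1 d'.
Proof.
move=> wt cc dd.
have H p (e e' : 'I_s -> 'I_p) : (forall l, e l <= e' l) ->
    coweight e' <= coweight e /\ (coweight e' = coweight e -> e =1 e').
  move=> ee.
  have L l : true -> p - (e' l).+1 <= p - (e l).+1 ?= iff (e l == e' l).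
    move=> _; split; first by have := ee l; lia.
    have := ee l; have := ltn_ord (e' l); rewrite -val_eqE /=.
    by case: eqP; case: eqP => //; lia.
  have [le eqL] := leqif_sum L; split=> // E l.
  by move: eqL; rewrite [X in X == _]E eqxx => /esym/forall_inP/(_ l isT)/eqP.
have [le1 E1] := H _ _ _ cc; have [le2 E2] := H _ _ _ dd.
by move: wt; rewrite /weight => wt; split; [apply: E1|apply: E2]; lia.
Qed.

Lemma sort_injective s m (c : 'I_s -> 'I_m) : injective c ->
  exists p : 'S_s, increasing (c \o p).
Proof.
move=> injc; pose t := [tuple nat_of_ord (c i) | i < s].
have /tuple_permP[p Ep] : perm_eq (sort leq t) t by rewrite perm_sort.
exists p; apply/increasingP => i j ij /=.
have srt : sorted ltn (sort leq t).
  rewrite ltn_sorted_uniq_leq sort_sorted ?andbT; last exact: leq_total.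
  by rewrite sort_uniq map_inj_uniq ?enum_uniq // => x y /val_inj/injc.
have nthE (l : 'I_s) : nth 0 (sort leq t) l = c (p l).
  by rewrite Ep -(tnth_nth 0 [tuple tnth t (p i) | i < s]) !tnth_mktuple.
rewrite -!nthE; apply: (sorted_ltn_nth ltn_trans 0 srt) => //;
  by rewrite inE size_sort size_tuple.
Qed.

End Index.

(** * Minors and their expansions *)

Section Minors.
Variable R : comNzRingType.
Local Open Scope ring_scope.

Implicit Types I Q : R -> Prop.

Definition minor s m n (c : 'I_s -> 'I_m) (d : 'I_s -> 'I_n)
  (A : 'M[R]_(m, n)) : R := \det (mxsub c d A).

Lemma minor_tr s m n (c : 'I_s -> 'I_m) (d : 'I_s -> 'I_n) A :
  minor d c A^T = minor c d A.
Proof.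
rewrite /minor -[RHS]det_tr; congr determinant.
by apply/matrixP => i j; rewrite !mxE.
Qed.

Lemma eq_minor s m n (c c' : 'I_s -> 'I_m) (d d' : 'I_s -> 'I_n) A :
  c =1 c' -> d =1 d' -> minor c d A = minor c' d' A.
Proof.
move=> cc dd; congr determinant.
by apply/matrixP => i j; rewrite !mxE cc dd.
Qed.

Lemma minor_perml s m n (c : 'I_s -> 'I_m) (d : 'I_s -> 'I_n) A (p : 'S_s) :
  minor (c \o p) d A = (-1) ^+ p * minor c d A.
Proof.
rewrite /minor -det_perm -det_mulmx -row_permE; congr determinant.
by apply/matrixP => i j; rewrite !mxE.
Qed.

Lemma minor_noninj s m n (c : 'I_s -> 'I_m) (d : 'I_s -> 'I_n) A :
  ~ injective c -> minor c d A = 0.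
Proof.
move=> ninj.
have /injectivePn[i [j ij cij]] : ~~ injectiveb c by apply/injectiveP.
by apply: (determinant_alternate ij) => k; rewrite !mxE cij.
Qed.

Lemma minor_cong I s m n (c : 'I_s -> 'I_m) (d : 'I_s -> 'I_n)
    (A B : 'M[R]_(m, n)) :
  is_ideal I -> (forall i j, I (A i j - B i j)) ->
  I (minor c d A - minor c d B).
Proof. by move=> idI AB; apply: cong_det => // i j; rewrite !mxE. Qed.

(** Padding [U] by zero columns and [V] by zero rows makes both square without changing the
    product. *)
Lemma det_mulmx_thin s p (U : 'M[R]_(p, s)) (V : 'M[R]_(s, p)) :
  (s < p)%N -> \det (U *m V) = 0.
Proof.
move=> sp; have [u Ep] : exists u, p = (s + u.+1)%N by exists (p - s).-1; lia.
subst p; have -> : U *m V = row_mx U 0 *m col_mx V (0 : 'M_(u.+1, _)).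
  by rewrite mul_row_col mul0mx addr0.
rewrite det_mulmx [X in _ * X](expand_det_row _ (rshift s ord0)).
by rewrite big1 ?mulr0 // => j _; rewrite col_mxEd mxE mul0r.
Qed.

(** Sorting the indices changes a minor by a sign and keeps its weight; a repeated index makes it
    zero. *)
Lemma minor_increasing I (W : nat -> Prop) s m n A : is_ideal I ->
  (forall (c : 'I_s -> 'I_m) (d : 'I_s -> 'I_n), increasing c ->
     increasing d -> W (weight c d) -> I (minor c d A)) ->
  forall (c : 'I_s -> 'I_m) (d : 'I_s -> 'I_n),
     W (weight c d) -> I (minor c d A).
Proof.
move=> idI inc c d Wcd.
have [/injectiveP/sort_injective[p ip]|/injectiveP ninj] :=
  boolP (injectiveb c);
  last by rewrite minor_noninj //; apply: idl0.
have [/injectiveP/sort_injective[q iq]|/injectiveP ninj] :=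
  boolP (injectiveb d);
  last by rewrite -minor_tr minor_noninj //; apply: idl0.
have := inc _ _ ip iq; rewrite /weight !coweight_perm => /(_ Wcd) Ipq.
rewrite -[minor c d A]mul1r -(sqrr_sign _ p) expr2 -mulrA -minor_perml.
rewrite -minor_tr -[minor d _ _]mul1r -(sqrr_sign _ q) expr2 -mulrA.
by rewrite -minor_perml minor_tr; do 2 apply: (idlMl idI).
Qed.

Definition ocons s m (i : 'I_m) (c : 'I_s -> 'I_m) (l : 'I_s.+1) : 'I_m :=
  oapp c i (unlift ord0 l).

Lemma ocons0 s m i (c : 'I_s -> 'I_m) : ocons i c ord0 = i.
Proof. by rewrite /ocons unlift_none. Qed.

Lemma oconsS s m i (c : 'I_s -> 'I_m) l : ocons i c (lift ord0 l) = c l.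
Proof. by rewrite /ocons liftK. Qed.

(** The new index goes to the front, not to place [l]: this is the row sequence of a cofactor of the
    bordered minor. *)
Definition replace s m (i : 'I_m) (c : 'I_s -> 'I_m) (l : 'I_s) :
    'I_s -> 'I_m :=
  ocons i c \o lift (lift ord0 l).

Lemma coweight_ocons s m i (c : 'I_s -> 'I_m) :
  coweight (ocons i c) = (m - i.+1 + coweight c)%N.
Proof.
rewrite /coweight big_ord_recl ocons0; congr (_ + _)%N.
by apply: eq_bigr => l _; rewrite oconsS.
Qed.

Lemma coweight_replace s m i (c : 'I_s -> 'I_m) l :
  (coweight (replace i c l) + (m - (c l).+1) = m - i.+1 + coweight c)%N.
Proof.
rewrite -coweight_ocons [in RHS]/coweight (bigD1_ord (lift ord0 l)) //= oconsS.
by rewrite addnC.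
Qed.

Lemma weight_ocons s m n i j (c : 'I_s -> 'I_m) (d : 'I_s -> 'I_n) :
  (weight c d < weight (ocons i c) (ocons j d))%N.
Proof. by rewrite /weight !coweight_ocons; lia. Qed.

Lemma weight_replace s m n (i : 'I_m) (c : 'I_s -> 'I_m) (d : 'I_s -> 'I_n) l :
  (i < c l)%N -> (weight c d < weight (replace i c l) d)%N.
Proof.
move=> ic; rewrite /weight; have := coweight_replace i c l.
by have := ltn_ord (c l); lia.
Qed.

(** The numerator in Cramer's rule for row [i] in terms of the rows [c]; the sign moves [i] from the
    front to place [l]. *)
Definition cramer_coef s m n (c : 'I_s -> 'I_m) (d : 'I_s -> 'I_n)
    (A : 'M[R]_(m, n)) (i : 'I_m) (l : 'I_s) : R :=
  (-1) ^+ l * minor (replace i c l) d A.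

Lemma minor_ocons s m n (c : 'I_s -> 'I_m) (d : 'I_s -> 'I_n) A i j :
  minor (ocons i c) (ocons j d) A =
  minor c d A * A i j - \sum_l cramer_coef c d A i l * A (c l) j.
Proof.
rewrite /minor (expand_det_col _ ord0) big_ord_recl; congr (_ + _).
  rewrite /cofactor !mxE !ocons0 addn0 expr0 mul1r mulrC; congr (_ * _).
  by congr determinant; apply/matrixP => a b; rewrite !mxE !oconsS.
rewrite -sumrN; apply: eq_bigr => l _.
rewrite /cofactor !mxE ocons0 oconsS addn0 lift0 exprS mulN1r mulNr mulrN.
congr (- _); rewrite mulrC; congr (_ * _ * _); congr determinant.
by apply/matrixP => a b; rewrite !mxE oconsS.
Qed.

(** * Elimination without division, modulo an ideal containing the heavier minors *)

Section Pivots.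
Variables (Q : R -> Prop) (s m n : nat) (A : 'M[R]_(m, n)).
Variables (c : 'I_s -> 'I_m) (d : 'I_s -> 'I_n).
Hypothesis idQ : is_ideal Q.
Hypothesis bigger : forall s' (c' : 'I_s' -> 'I_m) (d' : 'I_s' -> 'I_n),
  (s <= s')%N -> (weight c d < weight c' d')%N -> Q (minor c' d' A).

Lemma cramer_cong i j :
  Q (minor c d A * A i j - \sum_l cramer_coef c d A i l * A (c l) j).
Proof. by rewrite -minor_ocons; apply: bigger => //; apply: weight_ocons. Qed.

Lemma cramer_coef_in (i : 'I_m) (l : 'I_s) :
  (i < c l)%N -> Q (cramer_coef c d A i l).
Proof.
by move=> ic; apply: idlMl => //; apply: bigger => //; apply: weight_replace.
Qed.

(** For a row above all of [c], every Cramer coefficient comes from a heavier minor. *)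
Lemma pivot_entry (i : 'I_m) j :
  (forall l, (i < c l)%N) -> Q (minor c d A * A i j).
Proof.
move=> ic; apply: (idl_cong idQ (cramer_cong i j)).
apply: (idl_sum idQ) => l _. apply: idlMr => //; exact: cramer_coef_in.
Qed.

(** One factor of the pivot per row turns each row [e a] into a combination of the rows [c]. *)
Lemma pivot_minor s' (e : 'I_s' -> 'I_m) (f : 'I_s' -> 'I_n) :
  Q (minor c d A ^+ s' * minor e f A
     - \det ((\matrix_(a, l) cramer_coef c d A (e a) l) *m mxsub c f A)).
Proof.
rewrite -detZ; apply: cong_det => // a b; rewrite !mxE.
under eq_bigr do rewrite !mxE; exact: cramer_cong.
Qed.

Lemma pivot_size s' (e : 'I_s' -> 'I_m) (f : 'I_s' -> 'I_n) : (s < s')%N ->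
  Q (minor c d A ^+ s' * minor e f A).
Proof.
move=> ss'; apply: (idl_cong idQ (pivot_minor e f)).
by rewrite det_mulmx_thin //; apply: idl0.
Qed.

(** Coefficients in rows [a <= l] and columns [b >= l] lie in [Q], since [e a <= e l < c l <= c b].
    Every term of the coefficient determinant meets this block. *)
Lemma pivot_rows (e : 'I_s -> 'I_m) (f : 'I_s -> 'I_n) l :
  increasing c -> increasing e -> (e l < c l)%N ->
  Q (minor c d A ^+ s * minor e f A).
Proof.
move=> /increasingP ic /increasingP ie el.
apply: (idl_cong idQ (pivot_minor e f)); rewrite det_mulmx; apply: (idlMr idQ).
apply: idl_sum => // p _; apply: idlMl => //.
(* Pigeonhole: [p] cannot send the [l + 1] indices up to [l] into the [l] indices below it. *)
have [a al la] : exists2 a : 'I_s, (a <= l)%N & (l <= p a)%N.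
  apply/exists_inP; apply: contraT; rewrite negb_exists_in => /forall_inP H.
  pose B := [set b : 'I_s | (b <= l)%N]; pose C := [set b : 'I_s | (b < l)%N].
  have : (#|p @: B| <= #|C|)%N.
    apply: subset_leq_card; apply/subsetP => _ /imsetP[b + ->].
    by rewrite !inE => /H; rewrite -ltnNge.
  rewrite card_imset; last exact: perm_inj.
  have -> : B = l |: C by apply/setP => b; rewrite !inE leq_eqVlt.
  by rewrite cardsU1 inE ltnn /= add1n ltnn.
apply: (idl_prod idQ (i0 := a)); rewrite mxE; apply: cramer_coef_in.
have le_ea : (e a <= e l)%N.
  by move: al; rewrite leq_eqVlt => /predU1P[/val_inj->//|/ie/ltnW].
have le_cl : (c l <= c (p a))%N.
  by move: la; rewrite leq_eqVlt => /predU1P[/val_inj->//|/ic/ltnW].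
by lia.
Qed.

End Pivots.

Lemma pivot_entry_col Q s m n (A : 'M[R]_(m, n)) (c : 'I_s -> 'I_m)
    (d : 'I_s -> 'I_n) : is_ideal Q ->
  (forall s' (c' : 'I_s' -> 'I_m) (d' : 'I_s' -> 'I_n),
    (s <= s')%N -> (weight c d < weight c' d')%N -> Q (minor c' d' A)) ->
  forall i (j : 'I_n), (forall l, (j < d l)%N) -> Q (minor c d A * A i j).
Proof.
move=> idQ bigger i j jd.
have := @pivot_entry Q s n m A^T d c idQ _ j i jd; rewrite mxE minor_tr; apply.
move=> s' c' d'; rewrite minor_tr !(weightC _ c) !(weightC c').
exact: bigger.
Qed.

(* A weak straightening law. Up to elements of [Q] and a power of [minor c d A],
   the rows [e] of [A] are combinations of the rows [c], and the coefficient
   matrix is singular modulo [Q] unless [c <= e]; likewise for columns. So if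
   the product is not in [Q] then [c <= e] and [d <= f], and equality of the
   weights forces the two minors to coincide. *)
Lemma minor_mul Q v t m n (A : 'M[R]_(m, n)) : is_radical_ideal Q ->
  (forall s (c : 'I_s -> 'I_m) (d : 'I_s -> 'I_n),
    (t <= s)%N -> (v < weight c d)%N -> Q (minor c d A)) ->
  forall s (c : 'I_s -> 'I_m) (d : 'I_s -> 'I_n)
    s' (e : 'I_s' -> 'I_m) (f : 'I_s' -> 'I_n),
  (t <= s)%N -> (t <= s')%N -> increasing c -> increasing d -> increasing e ->
  increasing f -> weight c d = v -> weight e f = v ->
  (forall E : s = s', ~ ((forall l, c l = e (cast_ord E l)) /\
                        (forall l, d l = f (cast_ord E l)))) ->
  Q (minor c d A * minor e f A).
Proof.
move=> [idQ radQ] big s c d s' e f ts ts' ic id ie iF wcd wef neq.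
have rad x y k : Q (x ^+ k * y) -> Q (x * y).
  by move=> Qxy; apply: (radQ _ k.+1); rewrite exprMn exprS [y ^+ _]exprS
    -!mulrA; apply: idlMl => //; rewrite mulrA; apply: (idlMr idQ).
have big' (p : nat) : (t <= p)%N ->
    forall (c0 : 'I_p -> 'I_m) (d0 : 'I_p -> 'I_n), weight c0 d0 = v ->
    forall s' (c' : 'I_s' -> 'I_m) (d' : 'I_s' -> 'I_n), (p <= s')%N ->
      (weight c0 d0 < weight c' d')%N -> Q (minor c' d' A).
  by move=> tp c0 d0 -> s0 c' d' ps; apply: big; apply: leq_trans ps.
(* If the sizes differ, the smaller minor is the pivot that kills the larger one. *)
have [ss'|s's|ss'] := ltngtP s s'.
- by apply: rad; apply: pivot_size => //; apply: big'.
- by rewrite mulrC; apply: rad; apply: pivot_size => //; apply: big'.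
subst s'; have {}neq : ~ (c =1 e /\ d =1 f).
  move=> [ce df]; apply: (neq erefl); split=> l /=; rewrite cast_ord_id //.
have [/existsP[l el]|/existsPn ce] := boolP [exists l, (e l < c l)%N].
  by apply: rad; apply: (pivot_rows idQ _ _ ic ie el); apply: big'.
have [/existsP[l fl]|/existsPn df] := boolP [exists l, (f l < d l)%N].
  apply: rad; rewrite -minor_tr -[minor e f A]minor_tr.
  apply: (pivot_rows idQ _ _ id iF fl) => s' c' d' ss'.
  by rewrite minor_tr !(weightC _ c) !(weightC c'); apply: big'.
case: neq; apply: eq_increasing_le; first by rewrite wcd.
- by move=> l; rewrite leqNgt.
- by move=> l; rewrite leqNgt.
Qed.

End Minors.

(** * Sums of minors of equal weight *)

Section WeightSums.
Variable R : comNzRingType.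
Local Open Scope ring_scope.

(** This is [F_v]. Minors of all sizes from [t] on enter; finite functions make the index type
    finite. *)
Definition weight_sum t v m n (A : 'M[R]_(m, n)) : R :=
  \sum_(s < m.+1 | (t <= s)%N)
  \sum_(p : {ffun 'I_s -> 'I_m} * {ffun 'I_s -> 'I_n}
         | [&& increasing p.1, increasing p.2 & weight p.1 p.2 == v])
    minor p.1 p.2 A.

Lemma weight_sum_in (I : R -> Prop) t v m n (A : 'M[R]_(m, n)) : is_ideal I ->
  (forall s (c : 'I_s -> 'I_m) (d : 'I_s -> 'I_n), (t <= s)%N ->
     I (minor c d A)) ->
  I (weight_sum t v A).
Proof. by move=> idI IA; do 2 apply: (idl_sum idI) => ? ?; apply: IA. Qed.

(** Multiplying the sum by one of its minors kills all other terms modulo [Q] and leaves the square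
    of that minor. *)
Lemma minor_weight_sum Q t m n (A : 'M[R]_(m, n)) s (c : 'I_s -> 'I_m)
    (d : 'I_s -> 'I_n) : is_radical_ideal Q ->
  (forall s' (c' : 'I_s' -> 'I_m) (d' : 'I_s' -> 'I_n),
    (t <= s')%N -> (weight c d < weight c' d')%N -> Q (minor c' d' A)) ->
  (t <= s)%N -> increasing c -> increasing d ->
  Q (minor c d A * weight_sum t (weight c d) A) -> Q (minor c d A).
Proof.
move=> radQ; have [idQ rQ] := radQ => big ts ic id.
have sm : (s < m.+1)%N := increasing_size ic.
pose p0 := ([ffun l => c l], [ffun l => d l]).
have ic0 : increasing p0.1.
  by apply/increasingP => i j ij; rewrite !ffunE; apply: (increasingP _ ic).
have id0 : increasing p0.2.
  by apply/increasingP => i j ij; rewrite !ffunE; apply: (increasingP _ id).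
have w0 : weight p0.1 p0.2 = weight c d.
  by congr (_ + _ + _)%N; apply: eq_bigr => l _; rewrite ffunE.
have m0 : minor p0.1 p0.2 A = minor c d A.
  by apply: eq_minor => l; rewrite ffunE.
rewrite /weight_sum (bigD1 (Ordinal sm)) //= (bigD1 p0) /=; last first.
  by rewrite ic0 id0 w0 eqxx.
rewrite m0 -addrA mulrDr => Qsum; apply: (rQ _ 2); rewrite expr2.
apply: (idl_cong idQ _ Qsum); rewrite opprD addNKr -mulrN.
rewrite mulrN; apply: idlN => //; rewrite mulrDr.
apply: idlD => //; rewrite mulr_sumr; apply: (idl_sum idQ) => /=.
  move=> [e f] /andP[/and3P[/= ie jf /eqP wef] ne].
  apply: (minor_mul radQ big) => // E [ce df]; case/eqP: ne.
  by congr (_, _); apply/ffunP => l; rewrite ffunE (ce, df) cast_ord_id.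
move=> s' /andP[ts' ns]; rewrite mulr_sumr; apply: (idl_sum idQ) => /=.
move=> [e f] /and3P[/= ie jf /eqP wef].
apply: (minor_mul radQ big) => // E; case/eqP: ns.
by apply: val_inj => /=; rewrite E.
Qed.

Lemma minors_in Q t m n (A : 'M[R]_(m, n)) : is_radical_ideal Q ->
  (forall s (c : 'I_s -> 'I_m) (d : 'I_s -> 'I_n),
    (t <= s)%N -> increasing c -> increasing d ->
    (forall s' (c' : 'I_s' -> 'I_m) (d' : 'I_s' -> 'I_n),
      (t <= s')%N -> (weight c d < weight c' d')%N -> Q (minor c' d' A)) ->
    Q (minor c d A * weight_sum t (weight c d) A)) ->
  forall s (c : 'I_s -> 'I_m) (d : 'I_s -> 'I_n), (t <= s)%N ->
    Q (minor c d A).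
Proof.
move=> radQ step; have [idQ _] := radQ.
(* Induction on [u] descends through the weights, starting above the maximal weight [m * n]. *)
suff H u v s (c : 'I_s -> 'I_m) (d : 'I_s -> 'I_n) :
    (m * n < v + u)%N -> (t <= s)%N -> (v <= weight c d)%N -> Q (minor c d A).
  by move=> s c d ts; apply: (H (m * n).+1 0%N).
elim: u v s c d => [|u IH] v s c d mnv ts.
  apply: (minor_increasing (W := fun w => (v <= w)%N) idQ) => {}c {}d ic id.
  by have := weight_le ic id; lia.
apply: (minor_increasing (W := fun w => (v <= w)%N) idQ) => {}c {}d ic id.
rewrite leq_eqVlt => /predU1P[Ev|]; last by apply: IH => //; lia.
have big s' (c' : 'I_s' -> 'I_m) (d' : 'I_s' -> 'I_n) :
    (t <= s')%N -> (weight c d < weight c' d')%N -> Q (minor c' d' A).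
  by rewrite -Ev; apply: IH; lia.
by apply: (minor_weight_sum radQ big) => //; apply: step.
Qed.

(* Minors of weight at most [t ^ 2 + 2 * t] have size at most [t], since
   minors of size [t + 1] have weight at least [(t + 1) ^ 2]. *)
Lemma weight_position t r s m n (c : 'I_s -> 'I_m) (d : 'I_s -> 'I_n) :
  (0 < t <= s)%N -> (r <= 2 * t)%N -> increasing c -> increasing d ->
  weight c d = (t ^ 2 + r)%N ->
  forall l l', (m + n <= c l + d l' + 2 * t + r)%N.
Proof.
move=> /andP[t0 ts] r2t ic id w l l'; have := weight_ge ic id.
rewrite w => s2; have Es : s = t by rewrite -!mulnn in s2; nia.
subst s; case: t t0 {ts s2} r2t c d ic id w l l' => // t _ r2t c d ic id w l l'.
(* The first row and column are the extreme case. The size is now [t.+1], and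
   [t.+1 ^ 2 - t ^ 2 + 1 = 2 * t.+1] gives the constant. *)
have := weight_first ic id; rewrite w -!mulnn.
have := increasing_gap ic (leq0n l : ord0 <= l)%N.
have := increasing_gap id (leq0n l' : ord0 <= l')%N.
by rewrite /=; nia.
Qed.

Lemma eq_weight_sum t r m n (A B : 'M[R]_(m, n)) :
  (0 < t)%N -> (r <= 2 * t)%N ->
  (forall (i : 'I_m) (j : 'I_n), (m + n <= i + j + 2 * t + r)%N ->
     A i j = B i j) ->
  weight_sum t (t ^ 2 + r)%N A = weight_sum t (t ^ 2 + r)%N B.
Proof.
move=> t0 r2t AB; apply: eq_bigr => s ts; apply: eq_bigr => -[c d] /=.
move=> /and3P[ic id /eqP w]; congr determinant; apply/matrixP => l l'.
by rewrite !mxE; apply/AB/weight_position => //; rewrite t0.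
Qed.

(** By [weight_position], [c l <= i] and [d l' <= j] cannot both occur, so the entry lies above all
    rows or left of all columns of the minor. *)
Lemma weight_sum_entry Q t r m n (A : 'M[R]_(m, n)) s (c : 'I_s -> 'I_m)
    (d : 'I_s -> 'I_n) (i : 'I_m) (j : 'I_n) : is_ideal Q ->
  (forall s' (c' : 'I_s' -> 'I_m) (d' : 'I_s' -> 'I_n),
    (t <= s')%N -> (weight c d < weight c' d')%N -> Q (minor c' d' A)) ->
  (0 < t <= s)%N -> (r <= 2 * t)%N -> increasing c -> increasing d ->
  weight c d = (t ^ 2 + r)%N -> (i + j + 2 * t + r < m + n)%N ->
  Q (minor c d A * A i j).
Proof.
move=> idQ big t0s r2t ic id w ij; have pos := weight_position t0s r2t ic id w.
have {}big s' (c' : 'I_s' -> 'I_m) (d' : 'I_s' -> 'I_n) :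
    (s <= s')%N -> (weight c d < weight c' d')%N -> Q (minor c' d' A).
  by move=> ss'; apply: big; lia.
have [/forallP ci|/forallPn[l cl]] := boolP [forall l, (i < c l)%N].
  exact: pivot_entry.
apply: pivot_entry_col => // l'; have := pos l l'; lia.
Qed.

(** * Replacing the zeros by weight sums *)

Section Fill.
Variables (m n t k : nat) (X : 'M[R]_(m, n)) (z : nat -> 'I_m * 'I_n).
Hypothesis t_gt0 : (0 < t)%N.
Hypothesis k_le : (k <= 2 * t + 1)%N.
Hypothesis z_inj : forall a b, (a < k)%N -> (b < k)%N -> z a = z b -> a = b.
Hypothesis z_low : forall a, (a < k)%N ->
  ((z a).1 + (z a).2 + 2 * t + a < m + n)%N.
Hypothesis Xz : forall a, (a < k)%N -> X (z a).1 (z a).2 = 0.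

(* Step [b] changes only the entry [z b], which by [z_low] is not involved in
   [weight_sum t (t ^ 2 + b')] for [b' <= b]. Hence in [fill k] each entry [z a]
   equals [weight_sum t (t ^ 2 + a) (fill k)]. *)
Fixpoint fill a : 'M[R]_(m, n) :=
  if a is b.+1 then
    \matrix_(i, j) if (i, j) == z b then weight_sum t (t ^ 2 + b)%N (fill b)
                   else fill b i j
  else X.

Lemma fill_stable a b (i : 'I_m) (j : 'I_n) : (a <= b <= k)%N ->
  (m + n <= i + j + 2 * t + a)%N -> fill b i j = fill a i j.
Proof.
move=> + ij; elim: b => [|b IH]; first by case: a ij.
case: (ltngtP a b.+1) => [ab|//|-> //] /= bk.
rewrite mxE; case: eqP => [E|_]; last by apply: IH; lia.
by have := z_low bk; rewrite -E /=; lia.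
Qed.

(** The entry is written using [fill a]. Later steps keep the sum by [fill_stable], and keep the
    entry because the positions are distinct. *)
Lemma fill_z a b : (a < b <= k)%N ->
  fill b (z a).1 (z a).2 = weight_sum t (t ^ 2 + a)%N (fill b).
Proof.
move=> /andP[ab bk].
have -> : weight_sum t (t ^ 2 + a)%N (fill b) =
    weight_sum t (t ^ 2 + a)%N (fill a).
  by apply: eq_weight_sum => //; [lia|move=> i j; apply: fill_stable; lia].
elim: b ab bk => // b IH; rewrite ltnS leq_eqVlt => /predU1P[<-|ab] bk /=.
  by rewrite mxE -surjective_pairing eqxx.
rewrite mxE -surjective_pairing; case: eqP => [/z_inj E|_]; last first.
  by apply: IH; lia.
by have := E (ltn_trans ab bk) bk; lia.
Qed.

Lemma fill_other b i j : (forall a, (a < b)%N -> (i, j) <> z a) ->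
  fill b i j = X i j.
Proof.
elim: b => //= b IH ne; rewrite mxE; case: eqP => [/ne E|_].
  by have := E (ltnSn b).
by apply: IH => a ab; apply: ne; lia.
Qed.

Lemma fill_cong I b : is_ideal I -> (b <= k)%N ->
  (forall s (c : 'I_s -> 'I_m) (d : 'I_s -> 'I_n), (t <= s)%N ->
     I (minor c d X)) ->
  forall i j, I (fill b i j - X i j).
Proof.
move=> idI + IX; elim: b => [|b IH] bk i j /=.
  by rewrite subrr; apply: idl0.
have {}IH := IH (ltnW bk); rewrite mxE; case: eqP => [E|_ //].
have -> : X i j = 0 by rewrite -(Xz bk) -E.
rewrite subr0; apply: weight_sum_in => // s c d ts.
by apply: (idl_cong idI (minor_cong c d idI IH)); apply: IX.
Qed.

(** In [Y] a weight sum of weight [t ^ 2 + a] with [a < k] is the entry at [z a], so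
    [weight_sum_entry] replaces the missing hypothesis on it. *)
Lemma fill_minors Q : is_radical_ideal Q ->
  (forall v, (t ^ 2 + k <= v <= m * n)%N -> Q (weight_sum t v (fill k))) ->
  forall s (c : 'I_s -> 'I_m) (d : 'I_s -> 'I_n), (t <= s)%N ->
    Q (minor c d X).
Proof.
move=> radQ Qv; have [idQ _] := radQ; set Y := fill k.
have QY s (c : 'I_s -> 'I_m) (d : 'I_s -> 'I_n) : (t <= s)%N -> Q (minor c d Y).
  apply: minors_in => // {}s {}c {}d ts ic id big.
  have wge := weight_ge ic id; have wle := weight_le ic id.
  have t2 : (t ^ 2 <= weight c d)%N.
    by apply: leq_trans wge; rewrite leq_exp2r.
  have [kw|wk] := leqP (t ^ 2 + k)%N (weight c d).
    by apply: idlMl => //; apply: Qv; rewrite kw.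
  have Ew := esym (subnKC t2); rewrite [X in weight_sum _ X _]Ew.
  set a := (weight c d - t ^ 2)%N in Ew *; have ak : (a < k)%N by lia.
  rewrite -fill_z ?ak ?leqnn //; apply: (weight_sum_entry idQ big _ _ ic id Ew);
    by rewrite ?t_gt0 ?z_low //; lia.
(* The filled entries are weight sums of [Y] itself, hence in [Q] by [QY]. *)
have YX i j : Q (Y i j - X i j).
  have [/existsP[a /eqP E]|/existsPn ne] :=
    boolP [exists a : 'I_k, (i, j) == z a].
    have -> : X i j = 0 by rewrite -(Xz (ltn_ord a)) -E.
    have := fill_z (_ : a < k <= k)%N; rewrite -E /= ltn_ord leqnn => -> //.
    by rewrite subr0; apply: weight_sum_in.
  rewrite [Y i j]fill_other ?subrr; first exact: idl0.
  by move=> a ak; apply/eqP/(ne (Ordinal ak)).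
move=> s c d ts; apply: (idl_cong idQ (cong_sym idQ (minor_cong c d idQ YX))).
exact: QY.
Qed.

End Fill.

(** Laplace expansion lowers the size one by one down to [t]. *)
Lemma minor_in_minor_ideal m n t (X : 'M[R]_(m, n)) s (c : 'I_s -> 'I_m)
  (d : 'I_s -> 'I_n) : (t <= s)%N -> minor_ideal t X (minor c d X).
Proof.
have idI := ideal_gen_ideal (is_minor t X); rewrite -/(minor_ideal t X) in idI.
elim: s c d => [|s IH] c d ts.
  have E : t = 0%N by lia.
  subst t; apply: ideal_gen_mem; by exists c, d; split=> // -[[]].
move: ts; rewrite leq_eqVlt => /predU1P[E|ts].
  subst t.
  apply: (minor_increasing (W := fun=> True) idI) => // {}c {}d ic id _.
  by apply: ideal_gen_mem; exists c, d; split=> //; apply/increasingP.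
rewrite /minor (expand_det_col _ ord0); apply: (idl_sum idI) => i _.
apply: (idlMl idI); rewrite /cofactor; apply: (idlMl idI).
have -> : row' i (col' ord0 (mxsub c d X)) =
    mxsub (c \o lift i) (d \o lift ord0) X.
  by apply/matrixP => a b; rewrite !mxE.
exact: IH.
Qed.

End WeightSums.

(** * Ordering the zeros, and the bound *)

(** A position on the last antidiagonal goes first: all earlier antidiagonals are met, so its index
    is at most the size of [Z]. The hypothesis survives its removal, down to the empty set. *)
Lemma antidiag_sequence m n (Z : {set 'I_m * 'I_n}) :
  (forall p h, p \in Z -> 1 <= h <= antidiag p ->
     exists2 q, q \in Z & antidiag q = h) ->
  exists s : seq ('I_m * 'I_n), [/\ uniq s, s =i Z, size s = #|Z| &
    forall x0 a, a < size s -> antidiag (nth x0 s a) + a <= size s].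
Proof.
move E : #|Z| => k; elim: k Z E => [|k IH] Z E cons.
  by exists [::]; split=> // p; rewrite (cards0_eq E) inE.
have /set0Pn[p0 p0Z] : Z != set0 by rewrite -card_gt0 E.
have [p /= pZ pmax] := @arg_maxnP _ p0 (fun p => p \in Z) (@antidiag m n) p0Z.
have Ep : #|Z :\ p| = k by move: (cardsD1 p Z); rewrite pZ E; lia.
have [|s [us sZ ss H]] := IH _ Ep.
  move=> q h; rewrite !inE => /andP[qp qZ] hq.
  have [r rZ rh] := cons q h qZ hq; have [rp|rp] := eqVneq r p.
    (* If the position found on antidiagonal [h] is [p] itself, maximality puts [q] on [h] too. *)
    have := pmax q qZ; rewrite -rp rh => hq'.
    by exists q; [rewrite !inE rp qp|lia].
  by exists r; rewrite // !inE rp.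
have pk : antidiag p <= k.+1.
  rewrite -E cardE -(size_map (@antidiag m n)) -[X in X <= _](size_iota 1).
  apply: uniq_leq_size; first exact: iota_uniq.
  move=> h; rewrite mem_iota => hp.
  have [|q qZ <-] := cons p h pZ; first by lia.
  by apply: map_f; rewrite mem_enum.
exists (p :: s); split=> /=.
- by rewrite us sZ !inE eqxx.
- by move=> q; rewrite inE sZ !inE; case: eqP => [->|].
- by rewrite ss.
- by move=> x0 [|a] /= ak; [rewrite addn0 ss|have := H x0 a; lia].
Qed.

Lemma minor_ideal_up_to_radical (R : comNzRingType) (m n t k : nat)
    (X : 'M[R]_(m, n)) (Z : {set 'I_m * 'I_n}) :
  m <= n ->
  1 <= t <= m ->
  1 <= k <= minn (2 * t + 1) (m + n - 2 * t) ->
  #|Z| = k ->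
  on_consecutive_antidiags Z ->
  (forall p, p \in Z -> X p.1 p.2 = 0%R) ->
  generated_up_to_radical (minor_ideal t X) (m * n - t ^ 2 - k + 1).
Proof.
move=> mn /andP[t0 tm] /andP[k0]; rewrite leq_min => /andP[k2t kmn].
move=> cZ [h _ hZ] XZ.
have [p q pZ hq|s [us sZ ss sh]] := @antidiag_sequence m n Z.
  have /hZ hp : exists2 p', p' \in Z & antidiag p' = antidiag p by exists p.
  by apply/hZ; lia.
have [x0 _] : exists x0, x0 \in Z by apply/set0Pn; rewrite -card_gt0 cZ.
rewrite cZ in ss.
pose z := nth x0 s; pose I := minor_ideal t X; pose Y := fill t X z k.
have idI : is_ideal I := ideal_gen_ideal _.
have zZ a : a < k -> z a \in Z by move=> ak; rewrite -sZ mem_nth ?ss.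
have zinj a b : a < k -> b < k -> z a = z b -> a = b.
  by move=> ak bk /eqP; rewrite nth_uniq ?ss // => /eqP.
(* Combines [antidiag (z a) + a <= k] with [k <= m + n - 2 * t]; the strictness is the successor in
   [antidiag]. *)
have zlow a : a < k -> (z a).1 + (z a).2 + 2 * t + a < m + n.
  rewrite -ss => /(sh x0); rewrite -/(z a) ss.
  by case: (z a) => i j; rewrite /antidiag /=; lia.
have Xz a : a < k -> X (z a).1 (z a).2 = 0%R by move=> /zZ/XZ.
(* The remaining weights run from [t ^ 2 + k] to [m * n]. *)
pose f (i : 'I_(m * n - t ^ 2 - k + 1)) := weight_sum t (t ^ 2 + k + i) Y.
exists f => x; split; apply: radical_sub.
- exact/radical_radical/ideal_gen_ideal.
- apply: ideal_gen_sub => [|_ [c [d [_ _ ->]]]].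
    by case: (radical_radical (ideal_gen_ideal (fun y => exists i, y = f i))).
  apply: (fill_minors t0 k2t zinj zlow Xz) => //.
    exact/radical_radical/ideal_gen_ideal.
  move=> v vle; apply/sub_radical/ideal_gen_mem.
  have iP : v - (t ^ 2 + k) < m * n - t ^ 2 - k + 1.
    by move: (m * n) (t ^ 2) vle => a b; lia.
  by exists (Ordinal iP); rewrite /f /= subnKC //; case/andP: vle.
- exact: radical_radical.
- move=> y Iy; apply: sub_radical; move: y Iy.
  apply: ideal_gen_sub => // _ [i ->].
  have IX s' (c : 'I_s' -> 'I_m) (d : 'I_s' -> 'I_n) :
      t <= s' -> I (minor c d X).
    exact: minor_in_minor_ideal.
  apply: weight_sum_in => // s' c d ts.
  apply: (idl_cong idI (minor_cong c d idI (fill_cong Xz idI (leqnn k) IX))).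
  exact: IX.
Qed.

(* The natural-number subtractions are exact: 2t <= m + n, and the bound on k
   gives t^2 + k <= mn. *)
Theorem proposition4p1 (K : closedFieldType) (N m n t k : nat)
    (X : 'M[{mpoly K[N]}]_(m, n)) (Z : {set 'I_m * 'I_n}) :
  0 < m -> m <= n ->
  1 <= t <= m ->
  1 <= k <= minn (2 * t + 1) (m + n - 2 * t) ->
  #|Z| = k ->
  on_consecutive_antidiags Z ->
  (forall p, p \in Z -> X p.1 p.2 = 0%R) ->
  exists2 r : nat, is_ara (minor_ideal t X) r & r <= m * n - t ^ 2 - k + 1.
Proof.
move=> _ mn tm kP cZ hZ XZ; apply: is_ara_le.
exact: minor_ideal_up_to_radical kP cZ hZ XZ.
Qed.
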